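(* Let $\alpha=\dfrac{\pi^2+8\log(2/\pi)-2\pi}{8}$ and $\beta=0$. For every $x\in(0,\pi/2)$, $$\exp\left(\alpha-\frac{(\pi-2)x^2}{2\pi}\right)<\frac{(\pi-2)\cos x+2}{\pi}<\exp\left(\beta-\frac{(\pi-2)x^2}{2\pi}\right),$$ and the constants $\alpha$ and $\beta$ are best possible.
   Context: $\log$ is the natural logarithm. ''Best possible'' means that $\alpha$ cannot be replaced by any larger number in the left inequality and $\beta$ cannot be replaced by any smaller number in the right inequality, if the inequality is to hold for all $x\in(0,\pi/2)$. *)

(* Defs.v *)
From Stdlib Require Import Reals.
Open Scope R_scope.

Definition alpha : R := (PI ^ 2 + 8 * ln (2 / PI) - 2 * PI) / 8.

Definition beta : R := 0.

(* Main.v *)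
Require Import Defs.
From Stdlib Require Import Reals.
From Stdlib Require Import Lra.
From Coquelicot Require Import Coquelicot.
Open Scope R_scope.

(** With [k = PI - 2], the function
    [F x = ln ((k * cos x + 2) / PI) + k * x^2 / (2 * PI)] satisfies [F 0 = 0] and
    [F (PI/2) = alpha], so both inequalities and the optimality of the constants
    amount to [F] being strictly decreasing and continuous on [[0, PI/2]].
    The sign of [F'] is that of [g x = x * (k * cos x + 2) - PI * sin x], which
    vanishes at both [0] and [PI/2].  Moreover
    [g' x = 4 * sin (x/2) * h (x/2)] with [h t = sin t - k * t * cos t] strictly
    convex and [h 0 = 0], so [h] can change sign only from negative to positive;
    hence [g < 0] in between. *)

Lemma strictly_increasing_of_pos_derivative (f f' : R -> R) (a b : R) :
  (forall c, a <= c <= b -> is_derive f c (f' c)) ->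
  (forall c, a < c < b -> 0 < f' c) ->
  forall x y, a <= x -> x < y -> y <= b -> f x < f y.
Proof.
  intros df pos x y ax xy yb.
  destruct (MVT_cor2 f f' x y xy) as [c [eq hc]].
  { intros c hc; apply is_derive_Reals, df; lra. }
  assert (0 < f' c * (y - x)) by (apply Rmult_lt_0_compat; [apply pos|]; lra).
  lra.
Qed.

(** A rational bound from which [lra] gets [/ 2 < PI - 2] and the nonvanishing of [PI]. *)
Lemma three_lt_PI : 3 < PI.
Proof. pose proof PI2_3_2; unfold PI2 in *; lra. Qed.

(** Since [h 0 = 0] and [h s >= 0], the slope [h'] is nonnegative somewhere in [(0, s)]. By
    convexity it is positive beyond [s], so [h] increases strictly from [s] to [t]. *)
Lemma pos_of_sin_sub_mul_cos_nonneg (k s t : R) :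
  / 2 < k -> 0 < s -> s < t -> t <= PI / 2 ->
  0 <= sin s - k * s * cos s -> 0 < sin t - k * t * cos t.
Proof.
  intros hk hs st ht hs0.
  set (h := fun t => sin t - k * t * cos t) in *.
  set (h' := fun t => cos t - k * cos t + k * t * sin t).
  set (h'' := fun t => (2 * k - 1) * sin t + k * t * cos t).
  assert (dh : forall c, is_derive h c (h' c)).
  { intros c; unfold h, h'; auto_derive; [easy|ring]. }
  assert (dh' : forall c, is_derive h' c (h'' c)).
  { intros c; unfold h', h''; auto_derive; [easy|ring]. }
  (* Here [/ 2 < k] makes the coefficient [2 * k - 1] in [h''] positive. *)
  assert (h'_incr : forall x y, 0 <= x -> x < y -> y <= PI / 2 -> h' x < h' y).
  { apply strictly_increasing_of_pos_derivative with h''; [now intros; apply dh'|].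
    intros c hc; unfold h''.
    assert (0 < sin c) by (apply sin_gt_0; lra).
    assert (0 < cos c) by (apply cos_gt_0; lra).
    apply Rplus_lt_0_compat; repeat apply Rmult_lt_0_compat; lra. }
  destruct (MVT_cor2 h h' 0 s hs) as [c [eqc hc]].
  { intros; apply is_derive_Reals, dh. }
  destruct (MVT_cor2 h h' s t st) as [d [eqd hd]].
  { intros; apply is_derive_Reals, dh. }
  assert (h0 : h 0 = 0) by (unfold h; rewrite sin_0; ring).
  change (0 <= h s) in hs0; change (0 < h t).
  assert (0 <= h' c).
  { apply Rmult_le_reg_r with (s - 0); lra. }
  assert (h' c < h' d) by (apply h'_incr; lra).
  assert (0 < h' d * (t - s)) by (apply Rmult_lt_0_compat; lra).
  lra.
Qed.

Lemma mul_cos_lt_sin (x : R) :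
  0 < x < PI / 2 -> x * ((PI - 2) * cos x + 2) < PI * sin x.
Proof.
  intros hx.
  pose proof three_lt_PI as hpi.
  set (g := fun x => x * ((PI - 2) * cos x + 2) - PI * sin x).
  set (h := fun t => sin t - (PI - 2) * t * cos t).
  set (g' := fun x => 4 * sin (x / 2) * h (x / 2)).
  assert (dg : forall c : R, is_derive g c (g' c)).
  (* Half-angle formulas bring out the factor [sin (c / 2)]. *)
  { intros c; unfold g, g', h; auto_derive; [easy|].
    assert (hs : sin c = 2 * sin (c / 2) * cos (c / 2)).
    { rewrite <- sin_2a; f_equal; field. }
    assert (hc : cos c = 1 - 2 * sin (c / 2) * sin (c / 2)).
    { rewrite <- cos_2a_sin; f_equal; field. }
    rewrite hs, hc; field. }
  (* If [g x >= 0], the mean slope of [g] is nonnegative on [[0, x]] and nonpositive on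
     [[x, PI / 2]]. The points [c < d] realising these slopes contradict the one-way sign change of
     [h]. *)
  destruct (Rlt_or_le (g x) 0) as [lt|ge]; [unfold g in lt; lra|exfalso].
  destruct (MVT_cor2 g g' 0 x (proj1 hx)) as [c [eqc hc]].
  { intros; apply is_derive_Reals, dg. }
  destruct (MVT_cor2 g g' x (PI / 2) (proj2 hx)) as [d [eqd hd]].
  { intros; apply is_derive_Reals, dg. }
  assert (g0 : g 0 = 0) by (unfold g; rewrite sin_0; ring).
  assert (g1 : g (PI / 2) = 0) by (unfold g; rewrite sin_PI2, cos_PI2; field).
  assert (sc : 0 < sin (c / 2)) by (apply sin_gt_0; lra).
  assert (sd : 0 < sin (d / 2)) by (apply sin_gt_0; lra).
  assert (hc0 : 0 <= h (c / 2)).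
  { apply Rmult_le_reg_l with (4 * sin (c / 2)); [lra|].
    apply Rmult_le_reg_r with (x - 0); [lra|].
    fold (g' c); lra. }
  assert (hd0 : 0 < h (d / 2)).
  { apply pos_of_sin_sub_mul_cos_nonneg with (c / 2); trivial; lra. }
  assert (0 < g' d * (PI / 2 - x)).
  { repeat apply Rmult_lt_0_compat; lra. }
  lra.
Qed.

(** The function [F] of the overview. *)
Definition log_ratio (x : R) : R :=
  ln (((PI - 2) * cos x + 2) / PI) + (PI - 2) * x ^ 2 / (2 * PI).

Lemma numerator_pos (x : R) : 0 <= x <= PI / 2 -> 0 < (PI - 2) * cos x + 2.
Proof.
  intros hx; pose proof three_lt_PI.
  assert (0 <= cos x) by (apply cos_ge_0; lra).
  assert (0 <= (PI - 2) * cos x) by (apply Rmult_le_pos; lra).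
  lra.
Qed.

Lemma log_ratio_derive (x : R) :
  0 <= x <= PI / 2 ->
  is_derive log_ratio x
    ((PI - 2) / (PI * ((PI - 2) * cos x + 2))
       * (x * ((PI - 2) * cos x + 2) - PI * sin x)).
Proof.
  intros hx; pose proof three_lt_PI; pose proof (numerator_pos x hx).
  unfold log_ratio; auto_derive.
  - apply Rdiv_lt_0_compat; lra.
  - field; lra.
Qed.

Lemma log_ratio_decreasing (x y : R) :
  0 <= x -> x < y -> y <= PI / 2 -> log_ratio y < log_ratio x.
Proof.
  intros hx xy hy; apply Ropp_lt_cancel.
  pose proof three_lt_PI.
  apply (strictly_increasing_of_pos_derivative (fun x => - log_ratio x)
    (fun x => - ((PI - 2) / (PI * ((PI - 2) * cos x + 2))
       * (x * ((PI - 2) * cos x + 2) - PI * sin x))) 0 (PI / 2)); trivial.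
  - intros c hc; apply (is_derive_opp log_ratio), log_ratio_derive, hc.
  - intros c hc.
    pose proof (mul_cos_lt_sin c hc).
    pose proof (numerator_pos c ltac:(lra)).
    rewrite Ropp_mult_distr_r.
    apply Rmult_lt_0_compat; [|lra].
    apply Rdiv_lt_0_compat; [lra|apply Rmult_lt_0_compat; lra].
Qed.

Lemma log_ratio_0 : log_ratio 0 = beta.
Proof.
  pose proof three_lt_PI.
  unfold log_ratio, beta; rewrite cos_0.
  replace (((PI - 2) * 1 + 2) / PI) with 1 by (field; lra).
  rewrite ln_1; field; lra.
Qed.

Lemma log_ratio_PI2 : log_ratio (PI / 2) = alpha.
Proof.
  pose proof three_lt_PI.
  unfold log_ratio, alpha; rewrite cos_PI2.
  replace (((PI - 2) * 0 + 2) / PI) with (2 / PI) by (field; lra).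
  field; lra.
Qed.

(** Differentiability holds at the endpoints too, which gives the continuity there that optimality
    needs. *)
Lemma log_ratio_near (p e : R) :
  0 <= p <= PI / 2 -> 0 < e ->
  exists d, 0 < d /\ forall x, Rabs (x - p) < d ->
    Rabs (log_ratio x - log_ratio p) < e.
Proof.
  intros hp he.
  assert (cont : continuous log_ratio p).
  { apply (ex_derive_continuous log_ratio); eexists; apply log_ratio_derive, hp. }
  destruct (proj1 (filterlim_locally log_ratio (log_ratio p)) cont
              (mkposreal e he)) as [d hd].
  exists d; split; [apply cond_pos|exact hd].
Qed.

Lemma exp_ratio (x : R) :
  0 <= x <= PI / 2 ->
  ((PI - 2) * cos x + 2) / PI
    = exp (log_ratio x - (PI - 2) * x ^ 2 / (2 * PI)).
Proof.
  intros hx; pose proof three_lt_PI; pose proof (numerator_pos x hx).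
  unfold log_ratio; rewrite Rplus_minus_r, exp_ln; [easy|].
  apply Rdiv_lt_0_compat; lra.
Qed.

Theorem theorem1p21 :
  (forall x : R, 0 < x < PI / 2 ->
     exp (alpha - (PI - 2) * x ^ 2 / (2 * PI)) < ((PI - 2) * cos x + 2) / PI
     /\ ((PI - 2) * cos x + 2) / PI < exp (beta - (PI - 2) * x ^ 2 / (2 * PI)))
  /\ (forall a : R, alpha < a ->
        ~ (forall x : R, 0 < x < PI / 2 ->
             exp (a - (PI - 2) * x ^ 2 / (2 * PI)) < ((PI - 2) * cos x + 2) / PI))
  /\ (forall b : R, b < beta ->
        ~ (forall x : R, 0 < x < PI / 2 ->
             ((PI - 2) * cos x + 2) / PI < exp (b - (PI - 2) * x ^ 2 / (2 * PI)))).
Proof.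
  pose proof three_lt_PI as hpi.
  split; [|split].
  - intros x hx.
    rewrite exp_ratio, <- log_ratio_0, <- log_ratio_PI2 by lra.
    assert (log_ratio (PI / 2) < log_ratio x) by (apply log_ratio_decreasing; lra).
    assert (log_ratio x < log_ratio 0) by (apply log_ratio_decreasing; lra).
    split; apply exp_increasing; lra.
  - intros a ha H; rewrite <- log_ratio_PI2 in ha.
    (* With the gap as tolerance, [log_ratio] stays below [a] near [PI / 2], whereas [H] forces it
       above [a]. *)
    destruct (log_ratio_near (PI / 2) (a - log_ratio (PI / 2))) as [d [hd near]];
      [lra|lra|].
    (* The cap at 1 keeps [PI / 2 - m / 2] inside [(0, PI / 2)]; halving makes its distance to
       [PI / 2] strictly less than [d]. *)
    set (m := Rmin d 1).
    assert (hm : 0 < m /\ m <= d /\ m <= 1).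
    { unfold m; repeat split; [apply Rmin_pos; lra|apply Rmin_l|apply Rmin_r]. }
    specialize (near (PI / 2 - m / 2)); specialize (H (PI / 2 - m / 2)).
    rewrite exp_ratio in H by lra.
    pose proof (exp_lt_inv _ _ (H ltac:(lra))).
    assert (hx : Rabs (PI / 2 - m / 2 - PI / 2) < d) by (apply Rabs_def1; lra).
    apply near, Rabs_def2 in hx; lra.
  - intros b hb H; rewrite <- log_ratio_0 in hb.
    (* The mirror argument at [0]: [log_ratio] stays above [b] there, against [H]. *)
    destruct (log_ratio_near 0 (log_ratio 0 - b)) as [d [hd near]]; [lra|lra|].
    set (m := Rmin d 1).
    assert (hm : 0 < m /\ m <= d /\ m <= 1).
    { unfold m; repeat split; [apply Rmin_pos; lra|apply Rmin_l|apply Rmin_r]. }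
    specialize (near (m / 2)); specialize (H (m / 2)).
    rewrite exp_ratio in H by lra.
    pose proof (exp_lt_inv _ _ (H ltac:(lra))).
    assert (hx : Rabs (m / 2 - 0) < d) by (apply Rabs_def1; lra).
    apply near, Rabs_def2 in hx; lra.
Qed.
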